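(* For any sequence $(\gamma_i)_{0\le i\le n-1}>0$ and any $\varepsilon>0$, there exists an $L$-$\mathrm{QG}^+$ convex function $f$ that verifies, after $n$ iterations of the subgradient method with step-sizes $(\gamma_i)_{0\le i\le n-1}$, $$f(x_n)-f_\star\ \ge\ \frac L2\,L\gamma_{n-1}\,d(x_0,\mathcal{X}_\star)^2-\varepsilon .$$
   Context: The functions $f:\mathbb{R}^d\to\mathbb{R}$ considered are convex (closed, proper) and are assumed to have a non-empty set of global minimizers $\mathcal{X}_\star$; $f_\star=\min_{x} f(x)$; $d(x,\mathcal{X}_\star)=\min_{x_\star\in\mathcal{X}_\star}\|x-x_\star\|_2$. The function $f$ is $L$-quadratically upper bounded ($L$-$\mathrm{QG}^+$) if $f(x)-f_\star\le\frac L2 d(x,\mathcal{X}_\star)^2$ for all $x\in\mathbb{R}^d$. $\partial f(x)=\{g:\ f(y)\ge f(x)+\langle g,y-x\rangle\ \forall y\in\mathbb{R}^d\}$ is the subdifferential. The subgradient method with starting point $x_0$ and step-sizes $(\gamma_i)_{0\le i\le n-1}$ is: for $k=1,\dots,n$, query $g_{k-1}\in\partial f(x_{k-1})$ and set $x_k=x_{k-1}-\gamma_{k-1}g_{k-1}$. *)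

(* Defs.v *)
From HB Require Import structures.
From mathcomp Require Import all_boot all_order all_algebra.
From mathcomp Require Import all_classical all_reals all_analysis.

Set Implicit Arguments.
Unset Strict Implicit.
Unset Printing Implicit Defensive.

Import Order.TTheory GRing.Theory Num.Theory.

Local Open Scope classical_set_scope.
Local Open Scope ring_scope.

Section Definitions.
Variables (R : realType) (d : nat).
Implicit Types (f : 'rV[R]_d -> R) (x y g : 'rV[R]_d) (S : set 'rV[R]_d).

Definition dotv x y : R := \sum_(i < d) x 0 i * y 0 i.

(* The canonical norm `|x| on 'rV[R]_d is the sup norm, hence this one. *)
Definition norm2 x : R := Num.sqrt (dotv x x).

Definition argmin f : set 'rV[R]_d := [set x | forall y, f x <= f y].

(* The infimum is a minimum as soon as argmin f is nonempty. *)
Definition fmin f : R := inf (range f).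

(* The infimum is attained when S is closed and nonempty, in particular when
   S = argmin f for a convex f : 'rV[R]_d -> R that has a minimizer (such an f,
   being finite everywhere, is continuous, hence closed and proper). *)
Definition dist2 x S : R := inf [set norm2 (x - y) | y in S].

Definition QGplus (L : R) f : Prop :=
  forall x, f x - fmin f <= L / 2 * dist2 x (argmin f) ^+ 2.

Definition subdiff f x : set 'rV[R]_d :=
  [set g | forall y, f x + dotv g (y - x) <= f y].

(* x 0, ..., x n are the iterates; x is unconstrained beyond n. The choice of
   the subgradient at each query is left free. *)
Definition subgradient_method f (gamma : nat -> R) (n : nat) (x0 : 'rV[R]_d)
    (x : nat -> 'rV[R]_d) : Prop :=
  x 0%N = x0 /\
  forall k, (k < n)%N ->
    exists2 g, subdiff f (x k) g & x k.+1 = x k - gamma k *: g.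

End Definitions.

(* Main.v *)
Require Import Defs.
From HB Require Import structures.
From mathcomp Require Import all_boot all_order all_algebra.
From mathcomp Require Import all_classical all_reals all_analysis.
From mathcomp Require Import ring lra.

Set Implicit Arguments.
Unset Strict Implicit.
Unset Printing Implicit Defensive.

Import Order.TTheory GRing.Theory Num.Theory.

Local Open Scope classical_set_scope.
Local Open Scope ring_scope.

(** Put the minimizer at z = 0 and take x_0 = D e with |e| = 1. Choose a unit
vector p with <e, p> = 1/2; then m = e - p is also a unit vector, <e, m> = 1/2
and <p, m> = -1/2. The affine functions L D <m, x> - L D^2/2 and
L D <p, x> - L D^2/2 are both below L/2 |x|^2 and both vanish at x_0; one step of
size gamma from x_0 with subgradient L D m raises the second one to
L^2 D^2 gamma/2, the value to be reached. The worst function is the maximum of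
small perturbations of these two, of a small quadratic (which makes 0 the only
minimizer) and of an affine function with the small slope delta L D p. The latter
is active at x_0, ..., x_(n-2), and moves the iterates by O(delta) only, but
along -p, hence upwards for the m-piece, which is shifted so that it becomes the
active one exactly at x_(n-1). At every iterate before the last a single affine
piece is strictly active, so that the subgradient is unique. *)

(** * Euclidean inner product on row vectors *)

Lemma dotvC (R : realType) (d : nat) (x y : 'rV[R]_d) : dotv x y = dotv y x.
Proof. by apply: eq_bigr => i _; rewrite mulrC. Qed.

Lemma dotvDr (R : realType) (d : nat) (x y z : 'rV[R]_d) :
  dotv x (y + z) = dotv x y + dotv x z.
Proof. by rewrite -big_split; apply: eq_bigr => i _; rewrite mxE mulrDr. Qed.

Lemma dotvZr (R : realType) (d : nat) (a : R) (x y : 'rV[R]_d) :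
  dotv x (a *: y) = a * dotv x y.
Proof. by rewrite /dotv mulr_sumr; apply: eq_bigr => i _; rewrite mxE mulrCA. Qed.

Lemma dotvNr (R : realType) (d : nat) (x y : 'rV[R]_d) :
  dotv x (- y) = - dotv x y.
Proof. by rewrite -scaleN1r dotvZr mulN1r. Qed.

Lemma dotvDl (R : realType) (d : nat) (x y z : 'rV[R]_d) :
  dotv (x + y) z = dotv x z + dotv y z.
Proof. by rewrite dotvC dotvDr !(dotvC z). Qed.

Lemma dotvZl (R : realType) (d : nat) (a : R) (x y : 'rV[R]_d) :
  dotv (a *: x) y = a * dotv x y.
Proof. by rewrite dotvC dotvZr dotvC. Qed.

Lemma dotvNl (R : realType) (d : nat) (x y : 'rV[R]_d) :
  dotv (- x) y = - dotv x y.
Proof. by rewrite dotvC dotvNr dotvC. Qed.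

Lemma dotv0 (R : realType) (d : nat) (x : 'rV[R]_d) : dotv x 0 = 0.
Proof. by rewrite -(scale0r x) dotvZr mul0r. Qed.

Definition dotvE := (dotvDl, dotvDr, dotvNl, dotvNr, dotvZl, dotvZr).

Lemma dotv_ge0 (R : realType) (d : nat) (x : 'rV[R]_d) : 0 <= dotv x x.
Proof. by apply: sumr_ge0 => i _; rewrite -expr2 sqr_ge0. Qed.

Lemma dotv_eq0 (R : realType) (d : nat) (x : 'rV[R]_d) :
  (dotv x x == 0) = (x == 0).
Proof.
apply/idP/eqP => [|->]; last by rewrite dotv0.
rewrite psumr_eq0 => [/allP h|i _]; last by rewrite -expr2 sqr_ge0.
apply/rowP => i; rewrite mxE; apply/eqP.
by move: (h i (mem_index_enum i)); rewrite mulf_eq0 orbb.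
Qed.

(** Two directions at 60 degrees in the plane of the first two coordinates. On a line, unit vectors
    only have products 1 and -1. *)
Lemma exists_unit_pair (R : realType) (d : nat) : (2 <= d)%N ->
  exists e p : 'rV[R]_d, [/\ dotv e e = 1, dotv p p = 1 & dotv e p = 1 / 2].
Proof.
move=> d2; pose i := Ordinal (ltnW d2); pose j := Ordinal d2.
have dotd (k l : 'I_d) : dotv (delta_mx 0 k : 'rV[R]_d) (delta_mx 0 l) = (k == l)%:R.
  rewrite /dotv (bigD1 k) //= !mxE !eqxx mul1r big1 ?addr0 //.
  by move=> m /negPf mk; rewrite !mxE mk andbF mul0r.
have s3 : Num.sqrt 3 ^+ 2 = 3 :> R by rewrite sqr_sqrtr // ler0n.
exists (delta_mx 0 i), ((1 / 2) *: delta_mx 0 i + (Num.sqrt 3 / 2) *: delta_mx 0 j).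
have ij : (i == j) = false by [].
have ji : (j == i) = false by [].
rewrite !dotvE !dotd !eqxx ij ji; split=> //; last by rewrite mulr1 mulr0 addr0.
rewrite !mulr0 !mulr1 add0r addr0.
have -> : Num.sqrt 3 / 2 * (Num.sqrt 3 / 2) = Num.sqrt 3 ^+ 2 / 4 :> R by field.
by rewrite s3; field.
Qed.

(** * Convexity and subgradients of maxima of affine and quadratic pieces *)

Lemma convex_functionP (R : realType) (d : nat) (f : 'rV[R]_d -> R) :
  convex_function setT f <->
  forall t x y, 0 <= t <= 1 ->
    f (t *: x + (1 - t) *: y) <= t * f x + (1 - t) * f y.
Proof.
split=> [cf t x y /andP[t0 t1]|cf t x y _ _].
  exact: (cf (Itv01 t0 t1) x y (in_setT _) (in_setT _)).
by apply: cf; rewrite ge0 le1.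
Qed.

Lemma convex_max (R : realType) (d : nat) (f g : 'rV[R]_d -> R) :
  convex_function setT f -> convex_function setT g ->
  convex_function setT (fun x => Num.max (f x) (g x)).
Proof.
move=> /convex_functionP cf /convex_functionP cg.
apply/convex_functionP => t x y t01; have /andP[t0 t1] := t01.
have s0 : 0 <= 1 - t by rewrite subr_ge0.
rewrite ge_max; apply/andP; split.
  apply: (le_trans (cf t x y t01)).
  by rewrite lerD // ler_wpM2l // le_max lexx.
apply: (le_trans (cg t x y t01)).
by rewrite lerD // ler_wpM2l // le_max lexx orbT.
Qed.

(** Centring at [z], the future minimizer, makes [- c] the value there. *)
Definition affine (R : realType) (d : nat) (z a : 'rV[R]_d) (c : R) x : R :=
  dotv a (x - z) - c.

Definition quadratic (R : realType) (d : nat) (z : 'rV[R]_d) (k : R) x : R :=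
  k * dotv (x - z) (x - z).

Lemma convex_affine (R : realType) (d : nat) (z a : 'rV[R]_d) (c : R) :
  convex_function setT (affine z a c).
Proof.
apply/convex_functionP => t x y _; rewrite /affine !dotvE.
by rewrite le_eqVlt; apply/orP; left; apply/eqP; ring.
Qed.

Lemma convex_quadratic (R : realType) (d : nat) (z : 'rV[R]_d) (k : R) :
  0 <= k -> convex_function setT (quadratic z k).
Proof.
move=> k0; apply/convex_functionP => t x y /andP[t0 t1].
rewrite /quadratic -subr_ge0.
(* The convexity gap of the squared norm is exactly [t (1 - t) |x - y|^2]. *)
suff -> : t * (k * dotv (x - z) (x - z)) + (1 - t) * (k * dotv (y - z) (y - z)) -
    k * dotv (t *: x + (1 - t) *: y - z) (t *: x + (1 - t) *: y - z) =
    k * (t * (1 - t) * dotv (x - y) (x - y)).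
  by rewrite !mulr_ge0 ?dotv_ge0 ?subr_ge0.
rewrite !dotvE (dotvC y x) (dotvC z x) (dotvC z y); ring.
Qed.

(* Complete the square: L/2 |y|^2 - <a, y> + |a|^2 / (2 L) = |L y - a|^2 / (2 L). *)
Lemma affine_le_quadratic (R : realType) (d : nat) (L : R) (z a : 'rV[R]_d)
    (c : R) x :
  0 < L -> dotv a a <= 2 * L * c -> affine z a c x <= quadratic z (L / 2) x.
Proof.
move=> L0 ac; rewrite /affine /quadratic; move: (x - z) => y.
have := dotv_ge0 (L *: y - a); rewrite !dotvE (dotvC y a) => h.
have L20 : 0 < 2 * L by rewrite mulr_gt0.
rewrite -(ler_pM2l L20); nra.
Qed.

(** Convexity keeps [P] below the affine piece for a short way from [x] along [v = s - a]. There the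
    subgradient inequality for [s] gives [<s, v> <= <a, v>], that is [|v|^2 <= 0]. *)
Lemma subdiff_max_affine (R : realType) (d : nat) (P : 'rV[R]_d -> R)
    (z a : 'rV[R]_d) (c : R) x :
  convex_function setT P -> P x < affine z a c x ->
  subdiff (fun y => Num.max (P y) (affine z a c y)) x = [set a].
Proof.
move=> /convex_functionP cP Px.
have fx : Num.max (P x) (affine z a c x) = affine z a c x by apply/max_idPr/ltW.
apply/seteqP; split=> [s hs|_ -> y]; last first.
  rewrite fx le_max; apply/orP; right.
  by rewrite /affine !dotvE; lra.
(* [A] is the gap at [x] and [B] a positive bound on the rate at which [P] closes it along [v];
   [t = A / (A + B)] is then short enough, since [t * B <= A]. *)
pose v := s - a; pose A := affine z a c x - P x.
pose B := `|P (x + v) - P x - dotv a v| + 1.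
have A0 : 0 < A by rewrite subr_gt0.
have B0 : 0 < B by rewrite ltr_wpDl.
have AB0 : 0 < A + B by rewrite addr_gt0.
pose t := A / (A + B).
have t0 : 0 < t by rewrite divr_gt0.
have t1 : t <= 1 by rewrite ler_pdivrMr // mul1r lerDl ltW.
have tB : t * B <= A.
  by rewrite /t mulrAC ler_pdivrMr // ler_wpM2l ?ltW // ltrDr.
have := hs (x + t *: v); rewrite fx le_max => h.
have affv : affine z a c (x + t *: v) = affine z a c x + t * dotv a v.
  by rewrite /affine !dotvE; ring.
have Pv : P (x + t *: v) <= affine z a c (x + t *: v).
  have := cP t (x + v) x; rewrite (ltW t0) t1 => /(_ isT).
  have -> : t *: (x + v) + (1 - t) *: x = x + t *: v.
    by rewrite scalerDr scalerBl scale1r addrAC addrCA subrr addr0.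
  move/le_trans; apply; rewrite affv.
  have : t * (P (x + v) - P x - dotv a v) <= A.
    apply: le_trans tB; rewrite ler_pM2l //.
    by rewrite (le_trans (ler_norm _)) // lerDl.
  by rewrite /A; lra.
have {h} : affine z a c x + dotv s (x + t *: v - x) <= affine z a c x + t * dotv a v.
  by rewrite -affv; case/orP: h => // h; exact: le_trans h Pv.
have -> : x + t *: v - x = t *: v by rewrite addrC addKr.
rewrite dotvZr lerD2l ler_pM2l // => h.
have : dotv v v == 0.
  rewrite eq_le dotv_ge0 andbT; move: h; rewrite {3}/v dotvDl dotvNl; lra.
by rewrite dotv_eq0 subr_eq0 => /eqP.
Qed.

(** Singleton subdifferentials at the queries force the whole run, so a bound on one explicit
    trajectory holds for every choice of subgradients. *)
Lemma subgradient_method_unique (R : realType) (d : nat) (f : 'rV[R]_d -> R)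
    (gamma : nat -> R) (n : nat) (g u : nat -> 'rV[R]_d) :
  (forall k, (k < n)%N -> subdiff f (u k) = [set g k]) ->
  (forall k, (k < n)%N -> u k.+1 = u k - gamma k *: g k) ->
  subgradient_method f gamma n (u 0%N) u /\
  forall x, subgradient_method f gamma n (u 0%N) x -> x n = u n.
Proof.
move=> sub step; split.
  by split=> // k kn; exists (g k); [rewrite sub|exact: step].
move=> x [x0 xS]; suff: forall k, (k <= n)%N -> x k = u k by exact.
elim=> // k IH kn; have [h] := xS k kn.
by rewrite (IH (ltnW kn)) sub // => -> ->; rewrite step.
Qed.


(** [w] drives all steps but the last, [g] the last one, and [h] gives the value reached after it;
    the quadratic isolates the minimizer. *)
Definition hard_function (R : realType) (d : nat) (z : 'rV[R]_d) (k : R)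
    (w : 'rV[R]_d) (cw : R) (g : 'rV[R]_d) (cg : R) (h : 'rV[R]_d) (ch : R) x : R :=
  Num.max (quadratic z k x)
    (Num.max (affine z w cw x) (Num.max (affine z g cg x) (affine z h ch x))).

(** * Minimizer, growth and subdifferentials of the worst function *)

Section HardFunction.
Variables (R : realType) (d : nat) (z : 'rV[R]_d) (k : R).
Variables (w : 'rV[R]_d) (cw : R) (g : 'rV[R]_d) (cg : R) (h : 'rV[R]_d) (ch : R).
Hypothesis k0 : 0 < k.

Let f := hard_function z k w cw g cg h ch.

Lemma convex_hard_function : convex_function setT f.
Proof.
apply: convex_max; first exact/convex_quadratic/ltW.
apply: convex_max; first exact: convex_affine.
by apply: convex_max; exact: convex_affine.
Qed.

Lemma subdiff_hard_function_w x :
  quadratic z k x < affine z w cw x -> affine z g cg x < affine z w cw x ->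
  affine z h ch x < affine z w cw x -> subdiff f x = [set w].
Proof.
move=> qx gx hx.
(* Reorder the maximum so that the active piece is the outer affine one. *)
have -> : f = fun y => Num.max (Num.max (quadratic z k y)
    (Num.max (affine z g cg y) (affine z h ch y))) (affine z w cw y).
  by apply/funext => y; rewrite /f /hard_function (maxC (affine z w cw y)) maxA.
apply: subdiff_max_affine; last by rewrite !gt_max qx gx hx.
apply: convex_max; first exact/convex_quadratic/ltW.
by apply: convex_max; exact: convex_affine.
Qed.

Lemma subdiff_hard_function_g x :
  quadratic z k x < affine z g cg x -> affine z w cw x < affine z g cg x ->
  affine z h ch x < affine z g cg x -> subdiff f x = [set g].
Proof.
move=> qx wx hx.
have -> : f = fun y => Num.max (Num.max (quadratic z k y)
    (Num.max (affine z w cw y) (affine z h ch y))) (affine z g cg y).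
  apply/funext => y.
  by rewrite /f /hard_function (maxC (affine z g cg y)) !maxA.
apply: subdiff_max_affine; last by rewrite !gt_max qx wx hx.
apply: convex_max; first exact/convex_quadratic/ltW.
by apply: convex_max; exact: convex_affine.
Qed.

Hypotheses (cw0 : 0 <= cw) (cg0 : 0 <= cg) (ch0 : 0 <= ch).

Lemma hard_function_center : f z = 0.
Proof.
rewrite /f /hard_function /quadratic /affine subrr !dotv0 mulr0 !sub0r.
by apply/max_idPl; rewrite !ge_max !oppr_le0 cw0 cg0 ch0.
Qed.

Lemma hard_function_ge_quadratic x : quadratic z k x <= f x.
Proof. by rewrite /f /hard_function le_max lexx. Qed.

Lemma hard_function_ge0 x : 0 <= f x.
Proof.
by apply: le_trans (hard_function_ge_quadratic x); rewrite mulr_ge0 ?dotv_ge0 ?ltW.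
Qed.

(** The quadratic piece is positive away from [z], while no piece exceeds 0 at [z]. *)
Lemma argmin_hard_function : argmin f = [set z].
Proof.
apply/seteqP; split=> [x /(_ z)|_ -> y]; rewrite hard_function_center; last first.
  exact: hard_function_ge0.
move=> fx; have := le_trans (hard_function_ge_quadratic x) fx.
rewrite /quadratic pmulr_rle0 // => le0.
have : dotv (x - z) (x - z) == 0 by rewrite eq_le le0 dotv_ge0.
by rewrite dotv_eq0 subr_eq0 => /eqP.
Qed.

Lemma fmin_hard_function : fmin f = 0.
Proof.
have lb0 : lbound (range f) 0 by move=> _ [x _ <-]; exact: hard_function_ge0.
have r0 : range f 0 by exists z => //; exact: hard_function_center.
apply/eqP; rewrite eq_le; apply/andP; split.
  by apply: ge_inf => //; exists 0.
by apply: lb_le_inf => //; exists 0.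
Qed.

Lemma dist2_hard_function x : dist2 x (argmin f) = norm2 (x - z).
Proof.
rewrite /dist2 argmin_hard_function.
have -> : [set norm2 (x - y) | y in [set z]] = [set norm2 (x - z)].
  by apply/seteqP; split=> [_ [_ -> <-]|_ ->] //; exists z.
exact: inf1.
Qed.

(** With [z] as the only minimizer, the growth bound can be checked piece by piece against
    [L / 2 |x - z|^2]. *)
Lemma QGplus_hard_function L : 0 < L -> k <= L / 2 ->
  dotv w w <= 2 * L * cw -> dotv g g <= 2 * L * cg -> dotv h h <= 2 * L * ch ->
  QGplus L f.
Proof.
move=> L0 kL ww gg hh x.
rewrite fmin_hard_function subr0 dist2_hard_function /norm2 sqr_sqrtr ?dotv_ge0 //.
rewrite /f /hard_function !ge_max !affine_le_quadratic // !andbT.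
by rewrite ler_wpM2r ?dotv_ge0.
Qed.

End HardFunction.

(** * Degenerate case and choice of the small parameters *)

(* The claim for D = 0 only asks for f (x n) >= fmin f. *)
Lemma zero_function_case (R : realType) (d n : nat) (L eps c : R)
    (gamma : nat -> R) (x0 : 'rV[R]_d) : 0 <= L -> 0 <= eps ->
  exists f : 'rV[R]_d -> R,
    [/\ convex_function setT f,
        argmin f !=set0 /\ QGplus L f,
        dist2 x0 (argmin f) = 0,
        exists x, subgradient_method f gamma n x0 x
      & forall x, subgradient_method f gamma n x0 x ->
          f (x n) - fmin f >= c * dist2 x0 (argmin f) ^+ 2 - eps].
Proof.
move=> L0 eps0; pose f (x : 'rV[R]_d) : R := 0.
have fmin0 : fmin f = 0.
  rewrite /fmin (_ : range f = [set 0]) ?inf1 //.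
  by apply/seteqP; split=> [_ [x _ <-]|_ ->] //; exists 0.
have dist0 : dist2 x0 (argmin f) = 0.
  apply/eqP; rewrite eq_le; apply/andP; split.
    apply: ge_inf; first by exists 0 => _ [x _ <-]; exact: sqrtr_ge0.
    by exists x0; [move=> y|rewrite subrr /norm2 dotv0 sqrtr0].
  apply: lb_le_inf; last by move=> _ [x _ <-]; exact: sqrtr_ge0.
  by exists (norm2 (x0 - x0)), x0 => // y.
exists f; split=> //.
- by apply/convex_functionP => t x y _; rewrite !mulr0 addr0.
- split; first by exists 0 => y.
  by move=> x; rewrite fmin0 subrr mulr_ge0 ?sqr_ge0 ?divr_ge0.
- exists (fun _ => x0); split=> // k kn; exists 0; last by rewrite scaler0 subr0.
  by move=> y; rewrite dotvC dotv0 addr0.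
- by move=> x _; rewrite dist0 fmin0 expr0n mulr0 subrr sub0r oppr_le0.
Qed.

(* A value s of the elapsed time strictly between the last two queries; for
   m = 0 there is only one query and s has to be negative. *)
Lemma exists_switching_time (R : realType) (gamma : nat -> R) (m : nat) (mu : R) :
  0 < mu -> (forall i, (i < m.+1)%N -> 0 < gamma i) ->
  exists s, [/\ - mu <= s, s < \sum_(i < m) gamma i
    & forall k, (k < m)%N -> \sum_(i < k) gamma i < s].
Proof.
move=> mu0 pos; case: m pos => [|m] pos.
  by exists (- mu); split=> //; rewrite big_ord0 oppr_lt0.
exists (\sum_(i < m) gamma i + gamma m / 2).
have gm : 0 < gamma m by apply: pos; rewrite ltnS leqnSn.
have mono k : (k <= m)%N -> 0 <= \sum_(i < k) gamma i <= \sum_(i < m) gamma i.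
  move=> km; have nn i : (i <= m)%N -> 0 <= gamma i.
    by move=> im; apply/ltW/pos; rewrite ltnS (leq_trans im).
  rewrite sumr_ge0 => [|i _]; last by apply: nn; rewrite (leq_trans (ltnW (ltn_ord i))).
  rewrite -!(big_mkord xpredT gamma) (big_cat_nat (leq0n k) km) /= lerDl big_nat sumr_ge0 //.
  by move=> i /andP[_ /ltnW im]; exact: nn.
have /andP[s0 _] := mono m (leqnn m).
split; first lra.
  by rewrite big_ord_recr /=; lra.
move=> k; rewrite ltnS => /mono /andP[_]; lra.
Qed.

(** [A] will control the drift of the slow iterates, [B] the loss in the final value. Adding 1 to
    each denominator covers the value 0. *)
Lemma exists_small (R : realType) (A B eps : R) :
  0 <= A -> 0 <= B -> 0 < eps ->
  exists delta, [/\ 0 < delta, delta <= 1 / 4, delta * A <= 1 / 8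
    & delta * B <= eps].
Proof.
move=> A0 B0 eps0; pose a : R := 1 / 8 / (A + 1); pose b := eps / (B + 1).
have A1 : 0 < A + 1 by lra.
have B1 : 0 < B + 1 by lra.
have a0 : 0 < a by rewrite !divr_gt0.
have b0 : 0 < b by rewrite divr_gt0.
pose delta := Num.min (1 / 4) (Num.min a b).
have delta0 : 0 < delta by rewrite !lt_min a0 b0 divr_gt0.
have da : delta <= a by rewrite !ge_min lexx orbT.
have db : delta <= b by rewrite !ge_min lexx !orbT.
exists delta; split=> //; first by rewrite ge_min lexx.
- apply: (@le_trans _ _ (a * (A + 1))); last by rewrite divfK ?gt_eqF.
  by apply: ler_pM; rewrite ?lerDl // ltW.
- apply: (@le_trans _ _ (b * (B + 1))); last by rewrite divfK ?gt_eqF.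
  by apply: ler_pM; rewrite ?lerDl // ltW.
Qed.

(** * The worst-case instance, its trajectory and its final value *)

Theorem theorem2p2 (R : realType) (d n : nat) (L D eps : R)
    (gamma : nat -> R) (x0 : 'rV[R]_d) :
  (2 <= d)%N -> (1 <= n)%N -> 0 < L -> 0 <= D -> 0 < eps ->
  (forall i, (i < n)%N -> 0 < gamma i) ->
  exists f : 'rV[R]_d -> R,
    [/\ convex_function setT f,
        argmin f !=set0 /\ QGplus L f,
        dist2 x0 (argmin f) = D,
        exists x, subgradient_method f gamma n x0 x
      & forall x, subgradient_method f gamma n x0 x ->
          f (x n) - fmin f >=
          L / 2 * (L * gamma n.-1) * dist2 x0 (argmin f) ^+ 2 - eps].
Proof.
move=> d2; case: n => // m _ L0 D0 eps0 pos /=.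
have [<-|Dpos] := eqVneq 0 D; first by apply: zero_function_case; apply: ltW.
have {Dpos} Dpos : 0 < D by rewrite lt_def eq_sym Dpos.
have [e [p [ee pp ep]]] := exists_unit_pair R d2.
have pe : dotv p e = 1 / 2 by rewrite dotvC.
pose T k := \sum_(i < k) gamma i.
have T0 k : (k <= m)%N -> 0 <= T k.
  move=> km; apply: sumr_ge0 => i _; apply/ltW/pos.
  by rewrite ltnS (leq_trans (ltnW (ltn_ord i))).
(* This tolerance ensures [sw >= - delta / 8] below, even when [s] is negative. *)
have mu0 : 0 < 1 / (8 * L) by rewrite divr_gt0 ?mulr_gt0.
have [s [s_ge sTm Tks]] := exists_switching_time mu0 pos.
rewrite -/(T m) in sTm.
have {Tks} Tks k : (k < m)%N -> T k < s by exact: Tks.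
have gm0 : 0 < gamma m by exact: pos.
have Tm0 := T0 m (leqnn m).
have LT0 : 0 <= L * T m by rewrite mulr_ge0 // ltW.
have B0 : 0 <= L ^+ 2 * D ^+ 2 * (T m + gamma m / 2).
  by rewrite !mulr_ge0 ?sqr_ge0 ?addr_ge0 ?divr_ge0 // ltW.
have [delta [delta0 delta4 deltaT deltaB]] := exists_small LT0 B0 eps0.
pose S := L * D ^+ 2.
have S0 : 0 < S by rewrite mulr_gt0 ?exprn_gt0.
pose sw := delta * (L * s).
have sw_ge : - (delta / 8) <= sw.
  have : - (1 / 8) <= L * s.
    have -> : - (1 / 8) = L * - (1 / (8 * L)) :> R by field; rewrite gt_eqF.
    by rewrite ler_pM2l.
  by rewrite /sw -(ler_pM2l delta0); lra.
pose z := x0 - D *: e.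
(* [cw] leaves the [w]-piece the value [S * delta / 4] at [x0]; [k] is small enough for the
   quadratic to stay below it during the drift. *)
pose w := (delta * L * D) *: p; pose cw := S * (delta / 4).
(* [cg] is solved from the equality of the [g]- and [w]-pieces at [y sw]. The factor [1 - delta]
   makes room for this offset in [|g|^2 <= 2 L cg]. *)
pose g := ((1 - delta) * L * D) *: (e - p).
pose cg := S * ((1 - delta) / 2 - delta / 4 + sw * (1 + delta) / 2).
pose h := (L * D) *: p; pose ch := S * (1 / 2).
pose k := delta * L / 16.
pose f := hard_function z k w cw g cg h ch.
have k0 : 0 < k by rewrite divr_gt0 ?mulr_gt0.
have kL : k <= L / 2 by rewrite /k; nra.
have cw0 : 0 <= cw by rewrite mulr_ge0 ?divr_ge0 ?ltW.
have ch0 : 0 <= ch by rewrite mulr_ge0 ?divr_ge0 ?ltW.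
(* By [sw_ge] this reduces to [1/4 + (1 + delta)/16 <= (1 - delta)/2], true for [delta <= 1/4]. *)
have cg_ge : (1 - delta) ^+ 2 / 2 <=
    (1 - delta) / 2 - delta / 4 + sw * (1 + delta) / 2 by nra.
have ww : dotv w w <= 2 * L * cw.
  have -> : 2 * L * cw = L * S * (delta / 2) by rewrite /cw; field.
  have -> : dotv w w = L * S * delta ^+ 2 by rewrite /w /S !dotvE pp; ring.
  by rewrite ler_pM2l ?mulr_gt0 //; nra.
have gg : dotv g g <= 2 * L * cg.
  have -> : dotv g g = 2 * L * (S * ((1 - delta) ^+ 2 / 2)).
    by rewrite /g /S !dotvE ee pp ep pe; field.
  by rewrite /cg !ler_pM2l ?mulr_gt0.
have hh : dotv h h <= 2 * L * ch.
  have -> : 2 * L * ch = dotv h h by rewrite /h /ch /S !dotvE pp; field.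
  exact: lexx.
have cg0 : 0 <= cg.
  rewrite mulr_ge0 ?(ltW S0) //; apply: le_trans cg_ge.
  by rewrite divr_ge0 ?sqr_ge0.
(* The iterates before the last are y (t i), with t i = delta L (elapsed time). *)
pose y t := z + D *: (e - t *: p).
have yz t : y t - z = D *: (e - t *: p) by rewrite /y addrC addKr.
have qy t : quadratic z k (y t) = S * (delta * (1 - t + t ^+ 2) / 16).
  by rewrite /quadratic yz /k /S !dotvE ee pp ep pe; field.
have wy t : affine z w cw (y t) = S * (delta * (1 / 4 - t)).
  by rewrite /affine yz /w /cw /S !dotvE pp pe; field.
have gy t : affine z g cg (y t) =
    S * (delta * (1 / 4 - t) + (1 + delta) / 2 * (t - sw)).
  by rewrite /affine yz /g /cg /S !dotvE ee pp ep pe; field.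
have hy t : affine z h ch (y t) = S * - t.
  by rewrite /affine yz /h /ch /S !dotvE pp pe; field.
pose t i := delta * (L * T i).
have t_itv i : (i <= m)%N -> 0 <= t i <= 1 / 8.
  move=> im; apply/andP; split.
    by apply: mulr_ge0; [exact: ltW|apply: mulr_ge0; [exact: ltW|exact: T0]].
  apply: le_trans deltaT; rewrite /t !ler_pM2l //.
  move: im; rewrite leq_eqVlt => /orP[/eqP -> //|/Tks Tis].
  exact: ltW (lt_trans Tis sTm).
(* Index [m] is the last query; the other branch is the final iterate [m.+1]. *)
pose u i := if (i <= m)%N then y (t i) else y (t m) - gamma m *: g.
pose sg i := if (i < m)%N then w else g.
have u0 : u 0%N = x0.
  by rewrite /u /t /T big_ord0 /y !mulr0 scale0r subr0 subrK.
have sub i : (i < m.+1)%N -> subdiff f (u i) = [set sg i].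
  rewrite ltnS => im; rewrite /u /sg im.
  have /andP[t0 t8] := t_itv i im.
  have qw : quadratic z k (y (t i)) < affine z w cw (y (t i)).
    by rewrite qy wy ltr_pM2l // -mulrA ltr_pM2l //; move: (t i) t0 t8 => a; nra.
  have hw : affine z h ch (y (t i)) < affine z w cw (y (t i)).
    rewrite hy wy ltr_pM2l // (@le_lt_trans _ _ 0) ?oppr_le0 // pmulr_rgt0 //.
    by move: (t i) t8 => a; lra.
  (* The [g]-piece minus the [w]-piece is a positive multiple of [t i - sw], so the sign of
     [T i - s] decides which is active. *)
  have d1 : 0 < (1 + delta) / 2 by lra.
  have [lt_im|] := ltnP i m.
    apply: subdiff_hard_function_w => //.
    rewrite gy wy ltr_pM2l // gtrDl pmulr_rlt0 // subr_lt0 /t /sw.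
    by rewrite !ltr_pM2l // Tks.
  move=> mi; have {im mi} im : i = m by apply/eqP; rewrite eqn_leq im mi.
  have gw : affine z w cw (y (t i)) < affine z g cg (y (t i)).
    rewrite gy wy ltr_pM2l // ltrDl pmulr_rgt0 // subr_gt0 /t /sw im.
    by rewrite !ltr_pM2l.
  by apply: subdiff_hard_function_g => //; [exact: lt_trans qw gw|exact: lt_trans hw gw].
have step i : (i < m.+1)%N -> u i.+1 = u i - gamma i *: sg i.
  rewrite ltnS => im; rewrite /u /sg im; case: ltnP => [lt_im|mi]; last first.
    by have -> : i = m by apply/eqP; rewrite eqn_leq im mi.
  have -> : t i.+1 = t i + delta * (L * gamma i).
    by rewrite /t /T big_ord_recr /= !mulrDr.
  rewrite /y /w; move: (t i) => a.
  by apply/rowP => j; rewrite !mxE; ring.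
have [uS u_unique] := subgradient_method_unique sub step.
have dist : dist2 x0 (argmin f) = D.
  rewrite dist2_hard_function // /norm2.
  have -> : x0 - z = D *: e by rewrite /z opprB addrC subrK.
  by rewrite !dotvE ee mulr1 -expr2 sqrtr_sqr gtr0_norm.
exists f; split.
- exact: convex_hard_function.
- split; last exact: QGplus_hard_function.
  by exists z; rewrite argmin_hard_function.
- exact: dist.
- by exists u; rewrite -u0.
move=> x xS; rewrite dist fmin_hard_function // subr0.
rewrite (u_unique x) ?u0 // /u ltnn.
(* The [h]-piece alone gives the bound: as [<p, e - p> = -1/2], the step along [- g] raises it. *)
have : affine z h ch (y (t m) - gamma m *: g) <= f (y (t m) - gamma m *: g).
  by rewrite /f /hard_function !le_max lexx !orbT.
apply: le_trans.
have -> : affine z h ch (y (t m) - gamma m *: g) =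
    affine z h ch (y (t m)) - gamma m * dotv h g.
  by rewrite /affine !dotvE; ring.
rewrite hy /t /h /g !dotvE pe pp.
(* The loss comes from the drift up to time [T m] and from the factor [1 - delta] in [g]; [deltaB]
   bounds it by [eps]. *)
suff -> : S * - (delta * (L * T m)) -
    gamma m * (L * D * ((1 - delta) * L * D * (1 / 2 - 1))) =
    L / 2 * (L * gamma m) * D ^+ 2 - delta * (L ^+ 2 * D ^+ 2 * (T m + gamma m / 2)).
  by rewrite lerD2l lerN2.
by rewrite /S; field.
Qed.
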